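(* Let $X$ be a locally compact Hausdorff space and $\overline{X}$ a metrizable compactification of $X$. Let $(X,\mathcal{B},\mathbf{b})$ be the coarse proximity structure on $X$ induced by the compactification $\overline{X}$. Then $\overline{X}\setminus X$, identified with $\mathcal{U}X$, is completely traceable.
   Context: The coarse proximity structure induced by a compactification $\overline{X}$ of a locally compact Hausdorff space $X$ is $(X,\mathcal{B},\mathbf{b})$, where $\mathcal{B}$ is the set of all $K\subseteq X$ with $cl_X(K)$ compact, and $A\mathbf{b}B\iff cl_{\overline{X}}(A)\cap cl_{\overline{X}}(B)\cap(\overline{X}\setminus X)\neq\emptyset$ for $A,B\subseteq X$. Members of $\mathcal{B}$ are called bounded, other subsets of $X$ unbounded. Its boundary $\mathcal{U}X$ is defined as follows. The discrete extension of $\mathbf{b}$ is the separated proximity $\delta$ on $X$ given by $A\delta B\iff(A\cap B\neq\emptyset$ or $A\mathbf{b}B)$. A cluster of $(X,\delta)$ is a collection $\sigma$ of nonempty subsets of $X$ such that $A\delta B$ for all $A,B\in\sigma$; if $C\delta A$ for all $A\in\sigma$ then $C\in\sigma$; and if $A\cup B\in\sigma$ then $A\in\sigma$ or $B\in\sigma$. The Smirnov compactification $\mathfrak{X}$ is the set of all clusters with the separated proximity $\delta^*$: $\mathcal{A}\delta^*\mathcal{C}$ iff $A\delta C$ for all $A,C\subseteq X$ such that $A\in\sigma$ for every $\sigma\in\mathcal{A}$ and $C\in\sigma$ for every $\sigma\in\mathcal{C}$. Its topology (closure of $\mathcal{A}$ is $\{\sigma:\{\sigma\}\delta^*\mathcal{A}\}$)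 is compact Hausdorff; the points of $X$ are identified with the clusters containing a singleton, and $cl_{\mathfrak{X}}(A)=\{\sigma\in\mathfrak{X}:A\in\sigma\}$ for $A\subseteq X$. The boundary $\mathcal{U}X\subseteq\mathfrak{X}$ is the subspace of clusters containing no bounded set. The trace of $A\subseteq X$ is $A'=cl_{\mathfrak{X}}(A)\cap\mathcal{U}X$. For the structure induced by a compactification $\overline{X}$, $\mathcal{U}X$ is homeomorphic to (and identified with) $\overline{X}\setminus X$, with $A'$ corresponding to $cl_{\overline{X}}(A)\cap(\overline{X}\setminus X)$. A closed set $C\subseteq\mathcal{U}X$ is traceable if $A'=C$ for some unbounded $A\subseteq X$; $\mathcal{U}X$ is completely traceable if every nonempty closed $C\subseteq\mathcal{U}X$ is traceable. *)

(* Defs.v *)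
From HB Require Import structures.
From mathcomp Require Import all_boot all_order all_algebra.
From mathcomp Require Import all_classical all_reals.
From mathcomp Require Import topology.

Set Implicit Arguments.
Unset Strict Implicit.
Unset Printing Implicit Defensive.

Local Open Scope classical_set_scope.

(* [X] is regarded as the subspace [range i] of [Xbar]. *)
Definition compactification (X Xbar : topologicalType) (i : X -> Xbar) : Prop :=
  [/\ compact [set: Xbar],
      hausdorff_space Xbar,
      injective i,
      (forall A : set X, open A <-> exists2 U : set Xbar, open U & A = i @^-1` U)
    & dense (range i)].

Definition metrizable (R : realType) (T : topologicalType) : Prop :=
  exists (M : metricType R) (f : T -> M) (g : M -> T),
    [/\ cancel f g, cancel g f, continuous f & continuous g].

Definition induced_bounded (X : topologicalType) : set (set X) :=
  [set K | compact (closure K)].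

Definition induced_b (X Xbar : topologicalType) (i : X -> Xbar)
    (A B : set X) : Prop :=
  closure (i @` A) `&` closure (i @` B) `&` ~` range i !=set0.

Definition discrete_extension (X : Type) (b : set X -> set X -> Prop)
    (A B : set X) : Prop :=
  A `&` B !=set0 \/ b A B.

(* Clusters of a proximity, unrelated to the filter notion [cluster]. *)
Definition prox_cluster (X : Type) (delta : set X -> set X -> Prop)
    (sigma : set (set X)) : Prop :=
  [/\ forall A, sigma A -> A !=set0,
      forall A B, sigma A -> sigma B -> delta A B,
      forall C, (forall A, sigma A -> delta C A) -> sigma C
    & forall A B, sigma (A `|` B) -> sigma A \/ sigma B].

Definition smirnov (X : Type) (delta : set X -> set X -> Prop) :
    set (set (set X)) :=
  [set sigma | prox_cluster delta sigma].

Definition smirnov_prox (X : Type) (delta : set X -> set X -> Prop)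
    (AA CC : set (set (set X))) : Prop :=
  forall A C : set X,
    (forall sigma, AA sigma -> sigma A) ->
    (forall sigma, CC sigma -> sigma C) -> delta A C.

Definition smirnov_closure (X : Type) (delta : set X -> set X -> Prop)
    (AA : set (set (set X))) : set (set (set X)) :=
  [set sigma | smirnov delta sigma /\ smirnov_prox delta [set sigma] AA].

(* The copy in the Smirnov compactification of a subset [A] of [X]: a point [x]
   is identified with the cluster that contains the singleton [x]. *)
Definition smirnov_points (X : Type) (delta : set X -> set X -> Prop)
    (A : set X) : set (set (set X)) :=
  [set sigma | smirnov delta sigma /\ exists2 x, A x & sigma [set x]].

Definition boundary (X : Type) (bounded : set (set X))
    (b : set X -> set X -> Prop) : set (set (set X)) :=
  [set sigma | smirnov (discrete_extension b) sigma /\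
               forall K, bounded K -> ~ sigma K].

Definition trace (X : Type) (bounded : set (set X))
    (b : set X -> set X -> Prop) (A : set X) : set (set (set X)) :=
  let delta := discrete_extension b in
  smirnov_closure delta (smirnov_points delta A) `&` boundary bounded b.

(* Closed for the subspace topology of the boundary. *)
Definition boundary_closed (X : Type) (bounded : set (set X))
    (b : set X -> set X -> Prop) (C : set (set (set X))) : Prop :=
  let delta := discrete_extension b in
  exists F : set (set (set X)),
    [/\ F `<=` smirnov delta, smirnov_closure delta F = F
      & C = F `&` boundary bounded b].

Definition traceable (X : Type) (bounded : set (set X))
    (b : set X -> set X -> Prop) (C : set (set (set X))) : Prop :=
  exists2 A : set X, ~ bounded A & trace bounded b A = C.

Definition completely_traceable (X : Type) (bounded : set (set X))
    (b : set X -> set X -> Prop) : Prop :=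
  forall C : set (set (set X)),
    boundary_closed bounded b C -> C !=set0 -> traceable bounded b C.

(* Main.v *)
Require Import Defs.
From mathcomp Require Import all_boot all_order all_algebra.
From mathcomp Require Import all_classical all_reals.
From mathcomp Require Import topology.
From mathcomp Require Import lra.

(** The proof has a topological half and a proximity half.

    Topological half ([same_limits_in_dense_subset]): in a compact metrizable
    space with a dense subset [E], every set [D] has the same closure outside
    [E] as some subset [A] of [E].  For each [n], cover the space by finitely
    many balls of radius [1/(n+1)], and put into [A] one point of [E] from each
    of those balls that meets [D].  Every point of [D] is then a limit of [A].
    Conversely, a limit of [A] outside [E] stays away from the finitely many
    points chosen at the stages below any given [N], so it is a limit of points
    chosen at late stages, and these are uniformly close to [D].

    Proximity half: it transports this to the boundary.  A boundary cluster is
    exactly the family [cluster_at i y] of the sets whose closure contains some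
    point [y] of the remainder ([boundary_cluster_at], [boundary_clusterE]), and
    the trace of [A] consists of the boundary clusters having [A] as a member
    ([traceE]).  Hence a closed [C] in the boundary is a relatively closed set
    [D] of points of the remainder, and the set [A] obtained for [D] has trace
    [C].  Such an [A] is unbounded because it belongs to the members of [C],
    of which there is at least one. *)

Local Open Scope classical_set_scope.

Set Implicit Arguments.
Unset Strict Implicit.

Import Order.TTheory GRing.Theory Num.Theory.

(** * Subsets of a dense set with prescribed limit points *)

(** If no finite family of the [W c] covered the space, the complements of such
    finite unions would generate a proper filter, and a cluster point [y] of it
    would contradict [nbhs y (W y)]. *)
Lemma compact_finite_net (T : topologicalType) (W : T -> set T) :
  compact [set: T] -> (forall y, nbhs y (W y)) ->
  exists2 G, finite_set G & forall z, exists2 c, G c & W c z.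
Proof.
move=> cT nW; apply: contrapT => noG.
pose F := filter_from (@finite_set T) (fun G => ~` \bigcup_(c in G) W c).
have FF : ProperFilter F.
  apply: filter_from_proper.
    apply: filter_from_filter; first by exists set0; exact: finite_set0.
    move=> G H fG fH; exists (G `|` H); first by rewrite finite_setU.
    by rewrite bigcup_setU setCU.
  move=> G fG; apply: contrapT => /set0P/negP/negPn/eqP.
  rewrite -setCT => /setC_inj GT; apply: noG; exists G => // z.
  by have : [set: T] z by []; rewrite -GT => -[c]; exists c.
have [y [_ Fy]] := cT F FF filterT.
have /Fy/(_ (nW y))[z [+ Wz]] : F (~` W y).
  by exists [set y]; [exact: finite_set1 | rewrite bigcup_set1].
by [].
Qed.

(** Carries the metric balls of [M] back to [T], so that the construction below
    takes place in [T] and no closure has to be moved along the homeomorphism. *)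
Lemma homeo_nbhsP (R : realType) (T : topologicalType) (M : metricType R)
    (f : T -> M) (g : M -> T) :
  cancel f g -> continuous f -> continuous g ->
  forall (y : T) (B : set T),
    nbhs y B <-> exists2 e : R, (0 < e)%R & f @^-1` ball (f y) e `<=` B.
Proof.
move=> fK cf cg y B; split=> [yB|[e e0 eB]].
  have : nbhs (f y) (g @^-1` B) by apply: cg; rewrite fK.
  move=> /nbhs_ballP[e /= e0 eB]; exists e => // z /eB /=.
  by rewrite fK.
apply: filterS eB _; apply: cf; exact: nbhsx_ballx.
Qed.

Lemma small_radius (R : realType) (e : R) : (0 < e)%R ->
  exists N, forall n, (N <= n)%N -> (n.+1%:R^-1 < e)%R.
Proof.
move=> e0; exists (Num.truncn e^-1) => n Nn.
rewrite invf_plt ?posrE ?ltr0n//.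
by apply: (lt_le_trans (truncnS_gt _)); rewrite ler_nat.
Qed.

(** The set is the union of finite sets [A_ n], where [A_ n] has one point of [E]
    in each ball of a finite [1/(n+1)]-net that meets [D].  Finiteness of each
    stage is what prevents limit points outside [E] other than those of [D]. *)
Lemma same_limits_in_dense_subset (R : realType) (T : topologicalType) (E D : set T) :
  compact [set: T] -> hausdorff_space T -> metrizable R T -> dense E ->
  exists2 A, A `<=` E & closure A `&` ~` E = closure D `&` ~` E.
Proof.
move=> cT hT [M [f [g [fK _ cf cg]]]] dE.
have nP := homeo_nbhsP fK cf cg.
pose r n : R := (n.+1%:R^-1)%R.
pose W n c := f @^-1` ball (f c) (r n).
have r0 n : (0 < r n)%R by rewrite invr_gt0.
have W_nbhs n c : nbhs c (W n c) by apply/nP; exists (r n).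
have /choice[G GP] n : exists G : set T,
    finite_set G /\ forall z, exists2 c, G c & W n c z.
  by have [G] := compact_finite_net cT (W_nbhs n); exists G.
have /choice[p pP] (k : nat * T) : exists x, E x /\ W k.1 k.2 x.
  have : nbhs k.2 (W k.1 k.2) by [].
  rewrite nbhsE => -[U [oU Uk] UW].
  by have [x [Ux Ex]] := dE U (ex_intro _ _ Uk) oU; exists x; split=> //; exact: UW.
pose A_ n := [set p (n, c) | c in G n `&` [set c | W n c `&` D !=set0]].
have A_E n : A_ n `<=` E by move=> _ [c _ <-]; exact: (pP (n, c)).1.
exists (\bigcup_n A_ n); first by move=> x [n _ /A_E].
apply/seteqP; split=> z [zA nEz]; split=> //.
  move=> B /nP[e e0 eB].
  have [N NP] : exists N, forall n, (N <= n)%N -> (r n < e / 3)%R.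
    by apply: small_radius; rewrite divr_gt0.
  (* The early stages form a finite, hence closed, subset of [E], which [z]
     avoids; only stages [n >= N] are left near [z]. *)
  pose K := \bigcup_(n in `I_N) A_ n.
  have fK' : finite_set K.
    apply: bigcup_finite => // n _.
    by apply: finite_image; apply: finite_setIl; exact: (GP n).1.
  have zK : nbhs z (~` K).
    apply: open_nbhs_nbhs; split; last by move=> [n _ /A_E].
    apply: closed_openC.
    exact: (accessible_finite_set_closed.1 (hausdorff_accessible hT)).
  have [x [[n _ Anx] [nKx Wx]]] := zA _ (filterI zK (W_nbhs N z)).
  have Nn : (N <= n)%N.
    by rewrite leqNgt; apply/negP => nN; apply: nKx; exists n.
  move: Anx Wx => [c [_ [d [Wcd Dd]]] <-] Wx.
  exists d; split=> //; apply: eB; rewrite /preimage/=.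
  (* The three thirds are the steps from [z] to [p (n, c)], to [c], to [d]. *)
  have e3 : (e = e / 3 + e / 3 + e / 3)%R.
    by lra.
  rewrite e3.
  have le3 m : (N <= m)%N -> (r m <= e / 3)%R by move=> /NP/ltW.
  apply: (@ball_triangle _ _ (f c)); last exact: le_ball (le3 _ Nn) _ Wcd.
  apply: (@ball_triangle _ _ (f (p (n, c)))).
    exact: le_ball (le3 _ (leqnn N)) _ Wx.
  by apply: ball_sym; exact: le_ball (le3 _ Nn) _ (pP (n, c)).2.
move: z zA {nEz}.
suff DA : D `<=` closure (\bigcup_n A_ n).
  by move=> z /(closureS DA); rewrite -(closure_id _).1//; exact: closed_closure.
move=> d Dd B /nP[e e0 eB].
have [N NP] : exists N, forall n, (N <= n)%N -> (r n < e / 2)%R.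
  by apply: small_radius; rewrite divr_gt0.
have [c Gc Wcd] := (GP N).2 d.
exists (p (N, c)); split; first by exists N => //; exists c => //; split=> //; exists d.
apply: eB; rewrite /preimage/= (splitr e).
have le2 : (r N <= e / 2)%R by apply: ltW; exact: NP.
apply: (@ball_triangle _ _ (f c)).
  by apply: ball_sym; exact: le_ball le2 _ Wcd.
exact: le_ball le2 _ (pP (N, c)).2.
Qed.

(** * Clusters and traces *)

Lemma prox_clusterS (X : Type) (b : set X -> set X -> Prop) (s : set (set X))
    (A B : set X) :
  (forall A A' C, A `<=` A' -> b A C -> b A' C) ->
  prox_cluster (discrete_extension b) s -> A `<=` B -> s A -> s B.
Proof.
move=> bS [_ s2 smax _] AB sA; apply: smax => C sC.
have [[x [Ax Cx]]|bAC] := s2 A C sA sC; last by right; exact: bS bAC.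
by left; exists x; split=> //; exact: AB.
Qed.

(** As [b] relates nothing to the singleton of [x], this point is far from every
    set that misses it, like a point of a discrete space; so its cluster is the
    principal ultrafilter. *)
Lemma prox_cluster_point (X : Type) (b : set X -> set X -> Prop) (x : X) :
  (forall C, ~ b C [set x]) ->
  prox_cluster (discrete_extension b) [set C | C x].
Proof.
move=> bx; split=> [A Ax|A B Ax Bx|C Cmax|A B []]; first by exists x.
- by left; exists x.
- by have [[z [Cz <-]]|/bx] := Cmax [set x] erefl.
- by left.
- by right.
Qed.

(** The sets that belong to all point clusters over [A] are the supersets of [A],
    so [s] is close to these clusters when every member of [s] is near [A], that
    is, by maximality, when [A] is a member of [s]. *)
Lemma traceE (X : Type) (bounded : set (set X)) (b : set X -> set X -> Prop)
    (A : set X) :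
  (forall A B, b A B -> b B A) ->
  (forall A A' C, A `<=` A' -> b A C -> b A' C) ->
  (forall C x, ~ b C [set x]) ->
  trace bounded b A = [set s | boundary bounded b s /\ s A].
Proof.
move=> bC bS bx; apply/seteqP; split=> s /=.
  move=> [[cs sA] Us]; split=> //; have [_ _ smax _] := cs.
  apply: smax => B sB.
  have : discrete_extension b B A.
    apply: sA => [_ ->//|t [ct [x Ax tx]]].
    by apply: (prox_clusterS bS ct) tx => z ->.
  move=> [[x [Bx Ax]]|/bC bAB]; first by left; exists x.
  by right.
move=> [Us sA]; split=> //; have [cs _] := Us; split=> // B C /(_ _ erefl) sB sC.
have AC : A `<=` C.
  move=> x Ax; apply: (sC [set C | C x]).
  by split; [exact: prox_cluster_point | exists x].
have [_ s2 _ _] := cs.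
apply: s2 => //.
exact: (prox_clusterS bS cs AC).
Qed.

(** * Boundary clusters are points of the remainder *)

Lemma induced_bC (X Xbar : topologicalType) (i : X -> Xbar) (A B : set X) :
  induced_b i A B -> induced_b i B A.
Proof. by rewrite /induced_b setIC [X in _ `&` X]setIC setIC. Qed.

Lemma induced_bS (X Xbar : topologicalType) (i : X -> Xbar) (A A' C : set X) :
  A `<=` A' -> induced_b i A C -> induced_b i A' C.
Proof.
move=> AA' [y [[Ay Cy] ny]]; exists y; split=> //; split=> //.
by apply: closureS Ay; exact: image_subset.
Qed.

Lemma induced_b_point (X Xbar : topologicalType) (i : X -> Xbar) :
  hausdorff_space Xbar -> forall C x, ~ induced_b i C [set x].
Proof.
move=> hX C x [y [[_ +] ny]]; rewrite image_set1 -(closure_id _).1.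
  by move=> yx; apply: ny; exists x.
exact: accessible_closed_set1 (hausdorff_accessible hX) _.
Qed.

Lemma compactification_continuous (X Xbar : topologicalType) (i : X -> Xbar) :
  compactification i -> continuous i.
Proof.
move=> [_ _ _ oi _]; apply/continuousP => U oU.
by apply/oi; exists U.
Qed.

Lemma closure_bounded (X Xbar : topologicalType) (i : X -> Xbar) (K : set X) :
  compactification i -> induced_bounded K -> closure (i @` K) `<=` range i.
Proof.
move=> ci cK; have [_ hX _ _ _] := ci.
have cl : closed (i @` closure K).
  apply: compact_closed => //; apply: continuous_compact => //.
  exact/continuous_subspaceT/compactification_continuous.
move=> y /(closureS (image_subset i (@subset_closure _ K))).
by rewrite -(closure_id _).1// => -[x _ <-]; exists x.
Qed.

Lemma closure_preimage_nbhs (X Xbar : topologicalType) (i : X -> Xbar) (y : Xbar)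
    (V : set Xbar) :
  dense (range i) -> nbhs y V -> closure (i @` (i @^-1` V)) y.
Proof.
move=> di yV B yB.
have : nbhs y (V `&` B) by exact: filterI.
rewrite nbhsE => -[U [oU Uy] UVB].
have [z [Uz [x _ ix]]] := di U (ex_intro _ _ Uy) oU.
move: Uz; rewrite -ix => /UVB[Vx Bx].
by exists (i x).
Qed.

(** Regularity of the compactification, in terms of the proximity.  It serves in
    both directions of the identification of boundary clusters with points. *)
Lemma far_nbhs (X Xbar : topologicalType) (i : X -> Xbar) (y : Xbar)
    (A : set X) :
  compact [set: Xbar] -> hausdorff_space Xbar -> ~ closure (i @` A) y ->
  exists2 V, nbhs y V & ~ discrete_extension (induced_b i) (i @^-1` V) A.
Proof.
move=> cX hX nAy.
have /(compact_regular hX cX filterT)[V yV VA] : nbhs y (~` closure (i @` A)).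
  by apply: open_nbhs_nbhs; split=> //; apply: closed_openC; exact: closed_closure.
exists V => // -[[x [Vx Ax]]|[z [[Vz Az] _]]].
  apply: (VA (i x)); first exact: subset_closure.
  by apply: subset_closure; exists x.
by apply: (VA z) => //; move: Vz; apply: closureS => _ [x Vx <-].
Qed.

(** For [y] in the remainder this is the boundary cluster identified with [y]. *)
Definition cluster_at (X Xbar : topologicalType) (i : X -> Xbar) (y : Xbar) :
  set (set X) := [set A | closure (i @` A) y].

Lemma boundary_cluster_at (X Xbar : topologicalType) (i : X -> Xbar)
    (y : Xbar) :
  compactification i -> ~ range i y ->
  boundary (@induced_bounded X) (induced_b i) (cluster_at i y).
Proof.
move=> ci ny; have [cX hX _ _ di] := ci.
split; last by move=> K bK /(closure_bounded ci bK).
split=> [A Ay|A B Ay By|C Cmax|A B].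
- by have [_ [[x Ax _] _]] := Ay setT filterT; exists x.
- by right; exists y.
- apply: contrapT => /(far_nbhs cX hX)[V yV]; apply.
  have [[x [Cx Vx]]|/induced_bC bVC] := Cmax _ (closure_preimage_nbhs di yV).
    by left; exists x.
  by right.
- by rewrite /cluster_at/= image_setU closureU.
Qed.

(** The complements of the sets outside [s] form a proper filter, because [s]
    distributes over unions.  By compactness its image has a cluster point [y].
    A set in [s] whose closure misses [y] would be far from a neighborhood of
    [y]; that neighborhood would lie outside [s], and its complement in the
    filter.  Nor is [y] in [X]: by local compactness it would have a bounded
    neighborhood there, and bounded sets are outside [s]. *)
Lemma boundary_clusterE (X Xbar : topologicalType) (i : X -> Xbar)
    (s : set (set X)) :
  locally_compact [set: X] -> compactification i ->
  boundary (@induced_bounded X) (induced_b i) s ->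
  exists2 y, ~ range i y & s = cluster_at i y.
Proof.
move=> lcX ci [cs sb]; have [cX hX inji oi di] := ci.
have [s0 s2 smax sU] := cs.
have sS A B : A `<=` B -> s A -> s B.
  exact: (prox_clusterS (@induced_bS _ _ i) cs).
have [A0 sA0] : s !=set0.
  apply: contrapT => ns.
  by have /s0[] : s set0 by apply: smax => A sA; case: ns; exists A.
have sT : s setT by exact: sS sA0.
pose F : set_system X := [set A | ~ s (~` A)].
have FF : ProperFilter F.
  split; first by rewrite /F/= setC0.
  split; rewrite /F/=.
  - by rewrite setCT => /s0[].
  - by move=> A B nA nB; rewrite /F/= setCI => /sU[].
  - by move=> A B AB nA sB; apply: nA; apply: sS sB; exact: subsetC.
have [y [_ Fy]] := cX (i @ F) _ filterT.
have FC V : ~ s (i @^-1` V) -> (i @ F) (~` V).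
  by move=> nV sV; apply: nV; rewrite -[V]setCK preimage_setC; exact: sV.
have sy A : s A -> cluster_at i y A.
  move=> sA; apply: contrapT => /(far_nbhs cX hX)[V yV nVA].
  have FV : (i @ F) (~` V) by apply: FC => sV; apply: nVA; exact: s2.
  by have [z []] := Fy _ _ FV yV.
have ny : ~ range i y.
  move=> [x _ ixy]; subst y.
  have [K xK [cK clK]] := lcX x I.
  have : nbhs x K by apply: filterS (xK : nbhs x [set z | [set: X] z -> K z]) => z; exact.
  rewrite nbhsE => -[U0 [/oi[U oU U0E] U0x] U0K].
  rewrite {}U0E in U0x U0K.
  have bU : induced_bounded (i @^-1` U).
    apply: subclosed_compact cK _; first exact: closed_closure.
    by move=> z /(closureS U0K); rewrite -(closure_id _).1.
  have FU : (i @ F) (~` U) by apply: FC; exact: sb.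
  by have [z []] := Fy _ _ FU (open_nbhs_nbhs (conj oU U0x)).
exists y => //; apply/seteqP; split=> // A yA; apply: smax => B sB.
by right; exists y; do 2?split=> //; exact: sy.
Qed.

(** * Complete traceability *)

Unset Implicit Arguments.

Theorem theorem4p7 (R : realType) (X Xbar : topologicalType) (i : X -> Xbar)
    (X_locally_compact : locally_compact [set: X])
    (X_hausdorff : hausdorff_space X)
    (i_compactification : compactification i)
    (Xbar_metrizable : metrizable R Xbar) :
  completely_traceable (@induced_bounded X) (induced_b i).
Proof.
move=> C [F [_ Fcl CF]] [s0 Cs0].
have ci := i_compactification.
have [cX hX _ _ di] := ci.
pose D := [set y | ~ range i y /\ C (cluster_at i y)].
have [A' A'E A'D] := same_limits_in_dense_subset D cX hX Xbar_metrizable di.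
have iA : i @` (i @^-1` A') = A'.
  apply/seteqP; split=> [_ [x Ax <-]//|y Ay].
  by have [x _ xy] := A'E _ Ay; exists x; rewrite // /preimage /= xy.
pose A := i @^-1` A'.
(* [D] is closed in the remainder: if [y] is a limit of [D], then every set that
   belongs to all the clusters of [F] has [D], hence [y], in its closure, so the
   cluster of [y] is in the closure of [F], which is [F]. *)
have Dcl : closure D `&` ~` range i = D.
  apply/seteqP; split=> y; last by move=> Dy; split; [exact: subset_closure | exact: Dy.1].
  move=> [yD ny]; split=> //.
  have Uy := boundary_cluster_at ci ny.
  rewrite CF; split=> //; rewrite -Fcl; split; first exact: Uy.1.
  move=> B B' /(_ _ erefl) yB FB'.
  right; exists y; split=> //; split=> //.
  have : D `<=` closure (i @` B').
    by move=> d [_]; rewrite CF => -[Fd _]; exact: FB' Fd.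
  by move/closureS => /(_ _ yD); rewrite -(closure_id _).1//; exact: closed_closure.
have trA : trace (@induced_bounded X) (induced_b i) A = C.
  rewrite traceE; [|exact: induced_bC|exact: induced_bS|exact: induced_b_point].
  have AP y : ~ range i y -> cluster_at i y A <-> C (cluster_at i y).
    move=> ny; rewrite /cluster_at/= /A iA; split=> [yA|Cy].
      have : (closure A' `&` ~` range i) y by [].
      by rewrite A'D Dcl => -[].
    have : D y by [].
    by rewrite -Dcl -A'D => -[].
  apply/seteqP; split=> s.
    move=> [Us]; have [y ny ->] := boundary_clusterE X_locally_compact ci Us.
    by move/AP; exact.
  move=> Cs; have Us : boundary (@induced_bounded X) (induced_b i) s.
    by move: Cs; rewrite CF => -[].
  split=> //; move: Cs.
  have [y ny ->] := boundary_clusterE X_locally_compact ci Us.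
  by move/AP; exact.
exists A => // bA.
have : trace (@induced_bounded X) (induced_b i) A s0 by rewrite trA.
rewrite traceE; [|exact: induced_bC|exact: induced_bS|exact: induced_b_point].
by move=> [[_ nb] sA]; exact: nb bA sA.
Qed.
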